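(* Suppose $\Gamma$ is the cone of a finite regular graph, and choose the sink $v_*$ to be the cone point. Let $\mathcal{V}'$ be the set of non-sink vertices, $d:\mathcal{V}'\to\mathbb{Z}$ the degree function of $\Gamma$, $L'$ the reduced Laplacian, and let $\sigma\in\mathbb{Z}^{\mathcal{V}'}$. (a) Assume $\sigma$ is immutable and uniformly large. Then $\sigma=L'a$ for some uniformly large $a\in\mathbb{Z}^{\mathcal{V}'}$. (b) Assume $\sigma\ge 0$ and $\sigma=L'a$ for some uniformly large $a\in\mathbb{Z}^{\mathcal{V}'}$. Then $\sigma$ is immutable. In both cases, $u_\sigma^{\mathbb{R}}=a-d+1$.
   Context: The cone of a graph $H$ is obtained from $H$ by adding one new vertex (the cone point) joined by a single edge to each vertex of $H$. $\Gamma$ has vertex set $\mathcal{V}$, and $\mathcal{V}'=\mathcal{V}\setminus\{v_*\}$. For $v\in\mathcal{V}$, $d(v)$ is the degree of $v$ in $\Gamma$ (including edges to the sink). The Laplacian $L$ is the $\mathcal{V}\times\mathcal{V}$ matrix with $L_{vv}=d(v)$ and $L_{vw}=-\#(v,w)$ for $v\ne w$, where $\#(v,w)$ is the number of edges joining $v$ and $w$. The reduced Laplacian $L'$ is the $\mathcal{V}'\times\mathcal{V}'$ matrix obtained from $L$ by deleting the row and column of $v_*$; it is invertible over $\mathbb{R}$. Inequalities between functions on $\mathcal{V}'$ are pointwise, and constants such as $1$ denote constant functions. An element $\sigma\in\mathbb{Z}^{\mathcal{V}'}$ is uniformly large if $\sigma\ge d-1$. Odometers: for $G\in\{\mathbb{Z},\mathbb{R}\}$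 and $\sigma\in\mathbb{Z}^{\mathcal{V}'}$, the $G$-odometer $u_\sigma^G\in G^{\mathcal{V}'}$ is the (existing and unique) element satisfying $\sigma-L'u\le d-1$ and $u\ge 0$ which is minimal, i.e. $u_\sigma^G\le u$ for every $u\in G^{\mathcal{V}'}$ satisfying both inequalities. $\sigma$ is immutable if $u_\sigma^{\mathbb{Z}}=u_\sigma^{\mathbb{R}}$. *)

(* Defs.v *)
From HB Require Import structures.
From mathcomp Require Import all_boot all_order all_algebra.
From mathcomp Require Import classical_sets reals.

Set Implicit Arguments.
Unset Strict Implicit.
Unset Printing Implicit Defensive.

Import Order.TTheory GRing.Theory Num.Theory.
Local Open Scope ring_scope.

(* Finite undirected graphs without loops, multiple edges being allowed;
   [mult v w] is the number #(v,w) of edges joining v and w. *)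
Record multigraph := Multigraph {
  vertex :> finType;
  mult : vertex -> vertex -> nat;
  mult_sym : forall v w, mult v w = mult w v;
  mult_loopless : forall v, mult v v = 0%N }.

Definition degree (X : multigraph) (v : X) : nat := (\sum_(w : X) mult v w)%N.

Definition regular (H : multigraph) : Prop :=
  exists k : nat, forall v : H, degree v = k.

Section Cone.
Variable H : multigraph.

Definition cone_mult (x y : option H) : nat :=
  match x, y with
  | Some v, Some w => mult v w
  | None, None => 0
  | _, _ => 1
  end.

Lemma cone_mult_sym x y : cone_mult x y = cone_mult y x.
Proof. by case: x y => [v|] [w|] //=; exact: mult_sym. Qed.

Lemma cone_mult_loopless x : cone_mult x x = 0%N.
Proof. by case: x => [v|] //=; exact: mult_loopless. Qed.

Definition cone : multigraph := Multigraph cone_mult_sym cone_mult_loopless.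

Definition cone_point : cone := None.

End Cone.

Section Sandpile.
Variables (X : multigraph) (s : X).

Definition nonsink := {v : X | v != s}.

Definition deg : {ffun nonsink -> int} := [ffun v => (degree (val v))%:Z].

Definition laplacian (v w : X) : int :=
  if v == w then (degree v)%:Z else - (mult v w)%:Z.

Definition reduced_laplacian (v w : nonsink) : int :=
  laplacian (val v) (val w).

Definition lap_app (G : numDomainType) (u : {ffun nonsink -> G}) :
    {ffun nonsink -> G} :=
  [ffun v => \sum_(w : nonsink) (reduced_laplacian v w)%:~R * u w].

Definition uniformly_large (sigma : {ffun nonsink -> int}) : Prop :=
  forall v, deg v - 1 <= sigma v.

Definition odometer_feasible (G : numDomainType)
    (sigma : {ffun nonsink -> int}) (u : {ffun nonsink -> G}) : Prop :=
  (forall v, (sigma v)%:~R - lap_app u v <= (deg v - 1)%:~R) /\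
  (forall v, 0 <= u v).

Definition is_odometer (G : numDomainType)
    (sigma : {ffun nonsink -> int}) (u : {ffun nonsink -> G}) : Prop :=
  odometer_feasible sigma u /\
  forall u' : {ffun nonsink -> G}, odometer_feasible sigma u' ->
    forall v, u v <= u' v.

(* The element satisfying [is_odometer], unique by antisymmetry of <=; the
   default value 0 is used only if there is none, which does not happen for
   G = int or a [realType] when the graph is connected. *)
Definition odometer (G : numDomainType) (sigma : {ffun nonsink -> int}) :
    {ffun nonsink -> G} :=
  xget 0 [set u : {ffun nonsink -> G} | is_odometer sigma u]%classic.

Definition immutable (R : realType) (sigma : {ffun nonsink -> int}) : Prop :=
  odometer R sigma = [ffun v => (odometer int sigma v)%:~R].

End Sandpile.

(* Main.v *)
Require Import Defs.
From HB Require Import structures.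
From mathcomp Require Import all_boot all_order all_algebra.
From mathcomp Require Import classical_sets reals.

Set Implicit Arguments.
Unset Strict Implicit.
Unset Printing Implicit Defensive.

Import Order.TTheory GRing.Theory Num.Theory.
Local Open Scope ring_scope.

(** On the cone of [H] every row of the reduced Laplacian sums to [1], the
    single edge to the sink being the only one that is deleted.  Two facts
    follow.  First, [lap_app] fixes constants, and if [H] is regular then
    [deg - 1] is such a constant, so [lap_app (a - deg + 1)] is
    [lap_app a - (deg - 1)].  Second, [lap_app] satisfies a minimum principle,
    [lap_app_ge0]: at a vertex where [u] is least, [lap_app u] is at most [u],
    so [0 <= lap_app u] forces [0 <= u].

    By the minimum principle, a nonnegative solution [u] of
    [sigma - lap_app u = deg - 1] lies below every feasible function, hence is
    the odometer, over the integers and over the reals alike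
    ([odometer_of_exact]).  The equation says that [a := u + deg - 1] satisfies
    [lap_app a = sigma], and [0 <= u] says that [a] is uniformly large.

    For (b), [u := a - deg + 1] is an integral solution, so it is both
    odometers.  For (a), the minimum principle makes [lap_app] injective, hence
    surjective over a field ([lap_app_surj]); the real solution is nonnegative
    since [deg - 1 <= sigma], so it is the real odometer, and immutability says
    that it is integral. *)

Lemma odometerE (X : multigraph) (s : X) (G : numDomainType)
    (sigma : {ffun nonsink s -> int}) (u : {ffun nonsink s -> G}) :
  is_odometer sigma u -> odometer G sigma = u.
Proof.
move=> u_odo.
have /= [feas_o min_o] : is_odometer sigma (odometer G sigma).
  exact: (xgetI 0 (u_odo : [set w | is_odometer sigma w]%classic u)).
have [feas_u min_u] := u_odo.
by apply/ffunP=> v; apply: le_anti; rewrite min_o // min_u.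
Qed.

Lemma lap_appD (X : multigraph) (s : X) (G : numDomainType)
    (u w : {ffun nonsink s -> G}) : lap_app (u + w) = lap_app u + lap_app w.
Proof.
apply/ffunP=> v; rewrite !ffunE -big_split; apply: eq_bigr => x _.
by rewrite ffunE mulrDr.
Qed.

Lemma lap_appN (X : multigraph) (s : X) (G : numDomainType)
    (u : {ffun nonsink s -> G}) : lap_app (- u) = - lap_app u.
Proof.
apply/ffunP=> v; rewrite !ffunE -sumrN; apply: eq_bigr => x _.
by rewrite ffunE mulrN.
Qed.

Lemma lap_app_intr (X : multigraph) (s : X) (G : numDomainType)
    (u : {ffun nonsink s -> int}) :
  lap_app [ffun v => (u v)%:~R : G] = [ffun v => (lap_app u v)%:~R].
Proof.
apply/ffunP=> v; rewrite !ffunE rmorph_sum; apply: eq_bigr => x _ /=.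
by rewrite ffunE intrM intz.
Qed.

Section Cone.
Variable H : multigraph.
Local Notation V := (nonsink (cone_point H)).

Lemma degree_cone (v : V) :
  degree (val v) = (1 + \sum_(w : V) mult (val v) (val w))%N.
Proof.
rewrite /degree (bigD1 (cone_point H)) //=; congr (_ + _)%N.
  by case: v => -[].
rewrite (reindex_omap (val : V -> cone H) insub) => [|x xP].
  by apply: eq_bigl => w; rewrite valK eqxx (valP w).
by rewrite insubT.
Qed.

(** The Laplacian as a sum of differences along edges: the edge to the sink, at
    which [u] counts as [0], contributes [u v], every other edge [u v - u w]. *)
Lemma lap_app_cone (G : numDomainType) (u : {ffun V -> G}) (v : V) :
  lap_app u v = u v + \sum_(w : V) (u v - u w) *+ mult (val v) (val w).
Proof.
have sum_neq (S : nmodType) (F : V -> S) :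
    F v = 0 -> \sum_w F w = \sum_(w | w != v) F w.
  by move=> Fv; rewrite (bigD1 v) //= Fv add0r.
rewrite ffunE (bigD1 v) // /reduced_laplacian /laplacian eqxx degree_cone.
rewrite [in RHS]sum_neq ?mult_loopless //.
rewrite [X in (1 + X)%N]sum_neq ?mult_loopless //.
under [in RHS]eq_bigr do rewrite mulrnBl.
rewrite big_split addrA; congr (_ + _).
  by rewrite -pmulrn mulr_natl mulrS; congr (_ + _); exact/esym/sumrMnr.
apply: eq_bigr => w wNv; rewrite val_eqE eq_sym (negPf wNv) mulrNz.
by rewrite mulNr -pmulrn mulr_natl.
Qed.

Lemma lap_app_cst (G : numDomainType) (c : G) (u : {ffun V -> G}) :
  (forall v, u v = c) -> lap_app u = u.
Proof.
move=> uc; apply/ffunP=> v; rewrite lap_app_cone big1 ?addr0 // => w _.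
by rewrite !uc subrr mul0rn.
Qed.

(** Minimum principle: at a vertex where [u] is least, all the differences in
    [lap_app_cone] are nonpositive. *)
Lemma lap_app_ge0 (G : realDomainType) (u : {ffun V -> G}) :
  (forall v, 0 <= lap_app u v) -> forall v, 0 <= u v.
Proof.
move=> lap_ge0 v0.
case: (@Order.TotalTheory.arg_minP _ _ _ v0 xpredT u) => // v _ min_v.
apply: le_trans (min_v v0 isT); apply: le_trans (lap_ge0 v) _.
rewrite lap_app_cone gerDl; apply: sumr_le0 => w _.
by rewrite mulrn_wle0 // subr_le0 min_v.
Qed.

Lemma lap_app_le (G : realDomainType) (u w : {ffun V -> G}) :
  (forall v, lap_app u v <= lap_app w v) -> forall v, u v <= w v.
Proof.
move=> le_lap v; rewrite -subr_ge0.
have subE (f g : {ffun V -> G}) z : (f - g) z = f z - g z by rewrite !ffunE.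
rewrite -subE; apply: lap_app_ge0 => z.
by rewrite lap_appD lap_appN subE subr_ge0.
Qed.

(** Over a field, the injectivity given by the minimum principle is enough,
    the space of functions being finite-dimensional. *)
Lemma lap_app_surj (F : realFieldType) (f : {ffun V -> F}) :
  exists u : {ffun V -> F}, lap_app u = f.
Proof.
pose L (u : {ffun V -> F^o}) : {ffun V -> F^o} := lap_app (G := F) u.
have L_linear : linear L.
  move=> c u w; apply/ffunP=> v; rewrite !ffunE scaler_sumr -big_split.
  apply: eq_bigr => x _ /=; rewrite !ffunE mulrDr; congr (_ + _).
  exact: mulrCA.
pose L' : {linear {ffun V -> F^o} -> {ffun V -> F^o}} :=
  HB.pack L (GRing.isLinear.Build _ _ _ _ L L_linear).
have kerL : lker (linfun L') == 0%VS.
  apply/lker0P => u w; rewrite !lfunE => eqL.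
  apply/ffunP=> v; apply: le_anti.
  have eq_lap z : lap_app (G := F) u z = lap_app (G := F) w z.
    by move/ffunP: eqL; apply.
  by apply/andP; split; apply: lap_app_le => z; rewrite eq_lap.
exists ((linfun L')^-1%VF f).
by have := lker0_lfunVK kerL f; rewrite lfunE.
Qed.

(** Every feasible [w] has [lap_app u <= lap_app w]. *)
Lemma odometer_of_exact (G : realDomainType) (sigma : {ffun V -> int})
    (u : {ffun V -> G}) :
  (forall v, 0 <= u v) ->
  (forall v, lap_app u v = (sigma v - (deg (cone_point H) v - 1))%:~R) ->
  odometer G sigma = u.
Proof.
move=> u_ge0 lap_u; apply: odometerE; split; first split=> // v.
  by rewrite lap_u -rmorphB opprB addrCA subrr addr0.
move=> w [feas_w _]; apply: lap_app_le => v.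
by rewrite lap_u rmorphB lerBlDr -lerBlDl; exact: feas_w.
Qed.

Lemma deg_cone_regular : regular H ->
  exists c : int, forall v, deg (cone_point H) v = c.
Proof.
move=> [k Hk]; exists k.+1%:Z => -[[v|] //= vP]; rewrite ffunE /=.
congr Posz; rewrite -(Hk v) /degree (bigD1 (cone_point H)) //= add1n.
congr S; rewrite (reindex_omap (Some : H -> cone H) id) => [|[]//] /=.
by apply: eq_bigl => x; rewrite eqxx.
Qed.

(** Regularity makes [deg - 1] constant, hence fixed by [lap_app].  With
    [lap_app a = sigma], the right-hand side is [sigma - (deg - 1)], so the
    shifted function solves the equation of [odometer_of_exact]. *)
Lemma lap_app_shift (a : {ffun V -> int}) : regular H ->
  lap_app [ffun v => a v - deg (cone_point H) v + 1] =
  [ffun v => lap_app a v - (deg (cone_point H) v - 1)].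
Proof.
move=> /deg_cone_regular[c degc].
pose e : {ffun V -> int} := [ffun v => deg (cone_point H) v - 1].
have -> : [ffun v => a v - deg (cone_point H) v + 1] = a - e.
  by apply/ffunP=> v; rewrite !ffunE opprB -addrA [- _ + 1]addrC.
rewrite lap_appD lap_appN (@lap_app_cst _ (c - 1) e) => [|v]; last first.
  by rewrite ffunE degc.
apply/ffunP=> v; rewrite [RHS]ffunE [LHS]ffunE; congr (_ + _).
by rewrite !ffunE.
Qed.

End Cone.

Theorem corollary1p3 (R : realType) (H : multigraph) (Hreg : regular H)
    (sigma : {ffun nonsink (cone_point H) -> int}) :
  (immutable R sigma -> uniformly_large sigma ->
     exists a : {ffun nonsink (cone_point H) -> int},
       [/\ uniformly_large a,
           sigma = lap_app a
         & odometer R sigma =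
             [ffun v => (a v - deg (cone_point H) v + 1)%:~R]])
  /\
  (forall a : {ffun nonsink (cone_point H) -> int},
     (forall v, 0 <= sigma v) -> uniformly_large a -> sigma = lap_app a ->
     immutable R sigma /\
     odometer R sigma =
       [ffun v => (a v - deg (cone_point H) v + 1)%:~R]).
Proof.
set s := cone_point H.
split=> [imm large|a _ large sigmaE].
  (* (a): the real odometer makes every vertex attain the bound [deg - 1]. *)
- have [u lap_u] := lap_app_surj
    [ffun v => (sigma v - (deg s v - 1))%:~R : R].
  have u_ge0 : forall v, 0 <= u v.
    by apply: lap_app_ge0 => v; rewrite lap_u ffunE ler0z subr_ge0 large.
  have odoE : odometer R sigma = u.
    by apply: odometer_of_exact => // v; rewrite lap_u ffunE.
  set n := odometer int sigma in imm *.
  have uE v : u v = (n v)%:~R by rewrite -odoE imm ffunE.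
  pose a : {ffun nonsink s -> int} := [ffun v => n v + deg s v - 1].
  have nE : n = [ffun v => a v - deg s v + 1].
    by apply/ffunP=> v; rewrite !ffunE addrAC subrK addrK.
  exists a; split.
  + by move=> v; rewrite [a v]ffunE -addrA lerDr -(ler0z R) -uE.
    (* The equation between integers is checked in [R], where [n] is [u]. *)
  + apply/ffunP=> v; apply: (addIr (- (deg s v - 1))).
    apply: (@intr_inj R).
    have <- : lap_app n v = lap_app a v - (deg s v - 1).
      by rewrite nE lap_app_shift // ffunE.
    have -> : (lap_app n v)%:~R = lap_app u v.
      have -> : u = [ffun v => (n v)%:~R] by apply/ffunP=> z; rewrite uE ffunE.
      by rewrite lap_app_intr [RHS]ffunE.
    by rewrite lap_u [RHS]ffunE.
  + by rewrite odoE; apply/ffunP=> v; rewrite uE nE !ffunE.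
  (* (b): one integral function is the exact solution over both rings. *)
- pose n : {ffun nonsink s -> int} := [ffun v => a v - deg s v + 1].
  have n_ge0 v : 0 <= n v.
    have := large v; rewrite -subr_ge0 opprB.
    by rewrite [n v]ffunE -addrA [- _ + 1]addrC.
  have lap_n v : lap_app n v = sigma v - (deg s v - 1).
    by rewrite lap_app_shift // [LHS]ffunE sigmaE.
  have odoZ : odometer int sigma = n.
    by apply: odometer_of_exact => // v; rewrite lap_n intz.
  have odoR : odometer R sigma = [ffun v => (n v)%:~R].
    apply: odometer_of_exact => v; first by rewrite ffunE ler0z.
    by rewrite lap_app_intr ffunE lap_n.
  split; first by rewrite /immutable odoZ.
  by rewrite odoR; apply/ffunP=> v; rewrite !ffunE.
Qed.
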